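(* Let $\omega\in\widehat{\mathcal{D}}$. Then there is a constant $C=C(\omega)>0$ such that the reproducing kernels $D^\omega_a$ of the weighted Dirichlet space $\mathcal{D}^2_\omega$ satisfy $$|D^\omega_a(z)-1|\le C|\overline{a}z|\left(\int_1^{\kappa(a,z)}\frac{dt}{t^2\omega_t}+1\right),\quad \kappa(a,z)=\frac{2}{|1-\overline{a}z|},\quad a,z\in\mathbb{D}.$$
   Context: $\mathbb{D}=\{z\in\mathbb{C}:|z|<1\}$, and $dA$ is the normalized Lebesgue area measure on $\mathbb{D}$. A weight is a non-negative function on $\mathbb{D}$ integrable with respect to $dA$; it is radial if $\omega(z)=\omega(|z|)$. Moments: $\omega_x=\int_0^1 r^x\omega(r)\,dr$ for $x\ge1$. A radial weight $\omega$ (not almost everywhere zero) belongs to $\widehat{\mathcal{D}}$ if there is $C=C(\omega)>0$ such that $\omega_x\le C\omega_{2x}$ for all $1\le x<\infty$. The weighted Dirichlet space $\mathcal{D}^2_\omega$ consists of the analytic functions $f$ in $\mathbb{D}$ with $\|f\|_{\mathcal{D}^2_\omega}=\|f'\|_{A^2_\omega}+|f(0)|<\infty$, where $\|g\|_{A^2_\omega}^2=\int_{\mathbb{D}}|g|^2\omega\,dA$. Its reproducing kernel (with respect to the orthonormal basis $\{1\}\cup\{z^n/(n\sqrt{2\omega_{2n-1}})\}_{n\ge1}$) is $$D^\omega_a(z)=1+\frac{\overline{a}z}{2}\sum_{n=0}^\infty\frac{(\overline{a}z)^n}{(n+1)^2\omega_{2n+1}},\quad a,z\in\mathbb{D}.$$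 *)

(* Defs.v *)
From HB Require Import structures.
From mathcomp Require Import all_boot all_order all_algebra.
From mathcomp Require Import complex.
From mathcomp Require Import all_classical all_reals all_analysis.

Set Implicit Arguments.
Unset Strict Implicit.
Unset Printing Implicit Defensive.

Import Order.TTheory GRing.Theory Num.Theory.
Import numFieldNormedType.Exports.

Local Open Scope classical_set_scope.
Local Open Scope ring_scope.
Local Open Scope complex_scope.

(* The modulus of a complex number, as an element of R rather than R[i]. *)
Notation cabs := Normc.normc.

Definition unit_disk (R : realType) : set R[i] := [set z | cabs z < 1].

(* R[i] carries no measurable structure in the libraries, so area is measured
   on R * R, the point (x, y) standing for x +i* y. *)
Definition unit_disk_plane (R : realType) : set (R * R) :=
  [set p | unit_disk (p.1 +i* p.2)].

Definition on_plane (R : realType) (f : R[i] -> R) (p : R * R) : R :=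
  f (p.1 +i* p.2).

Lemma pi_inv_ge0 (R : realType) : 0 <= (pi : R)^-1.
Proof. by rewrite invr_ge0 pi_ge0. Qed.

Definition area (R : realType) :
    {measure set (measurableTypeR R * measurableTypeR R) -> \bar R} :=
  mscale (NngNum (pi_inv_ge0 R)) (lebesgue_measure \x lebesgue_measure)%E.

(* The product measure above lives on the Borel sigma-algebra. A function is
   Lebesgue integrable on the disk iff it agrees almost everywhere there with
   a Borel integrable function. *)
Definition disk_integrable (R : realType) (f : R[i] -> R) : Prop :=
  exists2 g : R * R -> R,
    (area R).-integrable (@unit_disk_plane R) (EFin \o g) &
    ae_eq (area R) (@unit_disk_plane R) (on_plane f) g.

(* Weights are total functions on R[i]; only their values on the unit disk
   are ever used. *)
Definition weight (R : realType) (omega : R[i] -> R) : Prop :=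
  (forall z, unit_disk z -> 0 <= omega z) /\ disk_integrable omega.

Definition radial (R : realType) (omega : R[i] -> R) : Prop :=
  forall z, unit_disk z -> omega z = omega (cabs z)%:C.

(* The moment omega_x, as an extended real number; it is a Lebesgue integral,
   hence the completed measure. *)
Definition moment (R : realType) (omega : R[i] -> R) (x : R) : \bar R :=
  (\int[@completed_lebesgue_measure R]_(r in `[0%R, 1%R[)
     (r `^ x * omega r%:C)%:E)%E.

Definition Dhat (R : realType) (omega : R[i] -> R) : Prop :=
  [/\ weight omega,
      radial omega,
      ~ ae_eq (area R) (@unit_disk_plane R) (on_plane omega) (cst 0) &
      exists2 C : R, 0 < C &
        forall x : R, 1 <= x -> (moment omega x <= C%:E * moment omega (2 * x))%E].

(* The reproducing kernel D^omega_a(z) of the weighted Dirichlet space: the sum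
   of e_n(z) * (e_n(a))^* over its orthonormal basis e_0 = 1 and
   e_n(z) = z^n / (n * sqrt (2 * omega_(2n-1))) for n >= 1, after the shift
   n := n + 1. *)
Definition dirichlet_kernel (R : realType) (omega : R[i] -> R) (a z : R[i])
    : R[i] :=
  1 + a^* * z / 2 *
    limn [series (a^* * z) ^+ n /
                 (n.+1%:R ^+ 2 * fine (moment omega n.*2.+1%:R))%:C]_n.

Definition kappa (R : realType) (a z : R[i]) : R := 2 / cabs (1 - a^* * z).

(* Main.v *)
Require Import Defs.
From HB Require Import structures.
From mathcomp Require Import all_boot all_order all_algebra.
From mathcomp Require Import complex.
From mathcomp Require Import all_classical all_reals all_analysis.
From mathcomp Require Import measurable_realfun.
From mathcomp Require Import ring lra zify.

Import Order.TTheory GRing.Theory Num.Theory.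
Import numFieldNormedType.Exports.

Local Open Scope classical_set_scope.
Local Open Scope ring_scope.
Local Open Scope complex_scope.

(** Write w for the product of z with the conjugate of a, m_x for the moments,
and c_n = 1 / ((n+1)^2 m_(2n+1)), so that D_a(z) - 1 is w/2 times the power
series sum c_n w^n. Split that series at N = floor (1 / |1 - w|).

The head is at most the sum of the c_n for n < N. Since m is nonincreasing and
doubling, each c_n with n >= 1 is comparable to the integral of 1 / (t^2 m_t)
over [n, n+1] ([kernel_coef_le]), so the head is controlled by the integral up
to kappa = 2 / |1 - w|.

The tail need not converge absolutely with the right bound, because c_n may
grow polynomially; its cancellation is extracted by summing by parts K times,
each time passing to the differences of c at the cost of a factor
1 / |1 - w| ([symbol_sum]). This is profitable because c behaves like a symbol: its
differences of every order k are O(c_n / n^k). The moments have this property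
since a k-th difference of r^(2n+1) in n brings out (r^2 - 1)^k, and
r^n (1 - r^2)^k is O(n^-k), while the remaining factor r^(n+1) only costs a
doubling ([moment_differences]); symbols are stable under products and
reciprocals ([symbolM], [symbolV]), which passes the property on to c
([kernel_coef_symbol]). Being a symbol also forces polynomial growth
([symbol_growth]), so for K large the last sum converges and the tail is
O(c_N / |1 - w|) ([symbol_tail]), which is again comparable to the integral of
1 / (t^2 m_t) over [N, 2N] ([kernel_coef_last]).

Taking differences of the moments requires an additive integral. A moment is
the supremum of the integrals of the simple functions below r^x omega(r), so
omega is first replaced by a measurable minorant with the same moments
([measurable_minorant]). Finally, by doubling, either all moments are positive
and finite, or they are all 0 or all infinite ([moment_dichotomy]); in
the last two cases the real numbers attached to them vanish and the kernel is
constantly 1. *)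

(** * Difference calculus of symbol type *)

Definition fdiff (R : realType) (a : nat -> R) (n : nat) : R := a n.+1 - a n.

(** Sequences whose j-th difference is O(g_n / (n+1)^j) for all j <= K: the
discrete analogue of the symbol classes of Fourier analysis. The recursion puts
the gain in the majorant, so that no binomial sums appear. *)
Fixpoint symbol (R : realType) (K : nat) (g a : nat -> R) : Prop :=
  (exists2 C, 0 <= C & forall n, `|a n| <= C * g n) /\
  match K with
  | 0 => True
  | K'.+1 => symbol R K' (fun n => g n / n.+1%:R) (fdiff R a)
  end.
Arguments fdiff {R}.
Arguments symbol {R}.

Section Symbol.
Context {R : realType}.
Implicit Types (g h a b : nat -> R) (K : nat).

Lemma symbol_bound K g a : symbol K g a ->
  exists2 C, 0 <= C & forall n, `|a n| <= C * g n.
Proof. by case: K => [|K] []. Qed.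

Lemma symbolW K g a : symbol K.+1 g a -> symbol K g a.
Proof.
by elim: K g a => [|K IH] g a [? ?]; split => //; exact: IH.
Qed.

Lemma symbol0 K g : (forall n, 0 <= g n) -> symbol K g (fun=> 0).
Proof.
elim: K g => [|K IH] g g0 /=; (split;
  first by exists 0 => // n; rewrite normr0 mul0r) => //.
rewrite (_ : fdiff _ = fun=> 0); last by apply/funext => n; rewrite /fdiff subrr.
by apply: IH => n; rewrite divr_ge0.
Qed.

Lemma symbolN K g a : symbol K g a -> symbol K g (fun n => - a n).
Proof.
elim: K g a => [|K IH] g a /= [[C C0 aC] aK]; (split;
  first by exists C => // n; rewrite normrN) => //.
rewrite (_ : fdiff _ = fun n => - fdiff a n); first exact: IH.
by apply/funext => n; rewrite /fdiff; ring.
Qed.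

Lemma symbolD K g a b : symbol K g a -> symbol K g b ->
  symbol K g (fun n => a n + b n).
Proof.
elim: K g a b => [|K IH] g a b /= [[C C0 aC] aK] [[D D0 bD] bK]; (split;
  first by exists (C + D); [exact: addr_ge0|
    move=> n; rewrite mulrDl (le_trans (ler_normD _ _))// lerD]) => //.
rewrite (_ : fdiff _ = fun n => fdiff a n + fdiff b n); first exact: IH.
by apply/funext => n; rewrite /fdiff; ring.
Qed.

Lemma symbol_shift K g a (B : R) : 0 <= B -> (forall n, 0 <= g n) ->
  (forall n, g n.+1 <= B * g n) -> symbol K g a -> symbol K g (fun n => a n.+1).
Proof.
move=> B0; elim: K g a => [|K IH] g a g0 gB /= [[C C0 aC] aK]; (split;
  first by exists (C * B); [exact: mulr_ge0|move=> n; rewrite -mulrA;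
    exact/(le_trans (aC _))/ler_wpM2l]) => //.
apply: (IH _ (fdiff a)) => // n; first by rewrite divr_ge0.
by rewrite mulrA ler_pM ?invr_ge0// lef_pV2 ?posrE// ler_nat.
Qed.

(** Discrete Leibniz rule: the difference of ab is (difference of a) times the
shift of b, plus a times (difference of b). The growth hypothesis on h absorbs
the shift. *)
Lemma symbolM K g h a b (B : R) : 0 <= B -> (forall n, 0 <= h n) ->
  (forall n, h n.+1 <= B * h n) -> symbol K g a -> symbol K h b ->
  symbol K (fun n => g n * h n) (fun n => a n * b n).
Proof.
move=> B0; elim: K g h a b => [|K IH] g h a b h0 hB aK bK.
  split => //; case: aK bK => [[C C0 aC] _] [[D D0 bD] _].
  exists (C * D) => [|n]; first exact: mulr_ge0.
  by rewrite normrM mulrACA ler_pM.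
split.
  case: aK bK => [[C C0 aC] _] [[D D0 bD] _].
  exists (C * D) => [|n]; first exact: mulr_ge0.
  by rewrite normrM mulrACA ler_pM.
rewrite (_ : fdiff _ = fun n => fdiff a n * b n.+1 + a n * fdiff b n); last first.
  by apply/funext => n; rewrite /fdiff; ring.
have aK' := symbolW _ _ _ aK; have bK' := symbolW _ _ _ bK.
case: aK bK => [_ aK] [_ bK]; apply: symbolD.
  rewrite (_ : (fun n => _ / _) = fun n => g n / n.+1%:R * h n); last first.
    by apply/funext => n; ring.
  by apply: IH => //; exact: (symbol_shift K h b B).
rewrite (_ : (fun n => _ / _) = fun n => g n * (h n / n.+1%:R)); last first.
  by apply/funext => n; ring.
apply: IH => // n; first by rewrite divr_ge0.
by rewrite mulrA ler_pM ?invr_ge0// lef_pV2 ?posrE// ler_nat.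
Qed.

(** The difference of 1/a_n is minus that of a_n divided by a_n a_(n+1), so the
claim for K+1 follows from the product rule and the claim for K. *)
Lemma symbolV K a (B : R) : 0 <= B -> (forall n, 0 < a n) ->
  (forall n, a n <= B * a n.+1) -> symbol K a a ->
  symbol K (fun n => (a n)^-1) (fun n => (a n)^-1).
Proof.
move=> B0 a0 aB; have hB n : (a n.+1)^-1 <= B * (a n)^-1.
  by rewrite ler_pdivlMr// ler_pdivrMl// mulrC.
have h0 n : 0 <= (a n)^-1 by rewrite invr_ge0 ltW.
have bd : exists2 C, 0 <= C & forall n, `|(a n)^-1| <= C * (a n)^-1.
  by exists 1 => // n; rewrite mul1r ger0_norm.
elim: K => [|K IH] aK; first by split.
split => //; have {}IH := IH (symbolW _ _ _ aK); case: aK => _ aK.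
rewrite (_ : fdiff _ = fun n => - (fdiff a n * (a n)^-1 * (a n.+1)^-1)); last first.
  by apply/funext => n; rewrite /fdiff; field; rewrite !gt_eqF.
rewrite (_ : (fun n => _ / _) = fun n => a n / n.+1%:R * (a n)^-1 * (a n)^-1);
  last by apply/funext => n; field; rewrite !gt_eqF.
apply: symbolN; apply: (symbolM _ _ _ _ _ B) => //.
  exact: (symbolM _ _ _ _ _ B).
exact: (symbol_shift _ _ (fun n => (a n)^-1) B).
Qed.

Lemma symbol_natS K :
  symbol K (fun n => n.+1%:R : R) (fun n => n.+1%:R).
Proof.
have bd : exists2 C, 0 <= C & forall n, `|n.+1%:R : R| <= C * n.+1%:R.
  by exists 1 => // n; rewrite mul1r normr_nat.
case: K => [|K]; split => //.
rewrite (_ : fdiff _ = fun=> 1); last first.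
  by apply/funext => n; rewrite /fdiff -natrB// subSnn.
rewrite (_ : (fun n => _ / _) = fun=> 1); last first.
  by apply/funext => n; rewrite divff.
have bd1 : exists2 C : R, 0 <= C & forall n : nat, `|1 : R| <= C * 1.
  by exists 1 => // n; rewrite normr1 mul1r.
case: K => [|K]; split => //.
rewrite (_ : fdiff _ = fun=> 0); last first.
  by apply/funext => n; rewrite /fdiff subrr.
by apply: symbol0 => n; rewrite divr_ge0.
Qed.

(** The ratio a_(n+1) / a_n is at most 1 + C/(n+1), which Bernoulli bounds by
((n+2)/(n+1))^L as soon as L >= C. *)
Lemma symbol_growth a : (forall n, 0 < a n) -> symbol 1 a a ->
  exists L, forall n m, (n <= m)%N ->
    a m / m.+1%:R ^+ L <= a n / n.+1%:R ^+ L.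
Proof.
move=> a0 [_ [[C C0 aC] _]].
have [L CL] : exists L, C <= L%:R.
  by exists (Num.truncn C).+1; rewrite ltW// truncnS_gt.
exists L => n m; elim: m => [|m IH]; first by rewrite leqn0 => /eqP ->.
rewrite leq_eqVlt => /predU1P[->//|]; rewrite ltnS => /IH; apply: le_trans.
rewrite ler_pdivrMr ?exprn_gt0// mulrAC -mulrA -expr_div_n mulrC.
have aS : a m.+1 <= (1 + L%:R / m.+1%:R) * a m.
  have := aC m; rewrite /fdiff ler_norml => /andP[_ h].
  rewrite mulrDl mul1r -lerBlDl (le_trans h)// mulrCA mulrC ler_pM2r//.
  by rewrite ler_wpM2r// invr_ge0.
rewrite (le_trans aS)// ler_pM2r//.
rewrite (_ : m.+2%:R / m.+1%:R = 1 + m.+1%:R^-1); last first.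
  by rewrite -[m.+2%:R]natr1 mulrDl divff// mul1r.
elim: (L) => [|l IHl]; first by rewrite mul0r addr0 expr0.
have : 0 <= (m.+1%:R : R)^-1 by rewrite invr_ge0.
move: IHl; set x := m.+1%:R^-1 => IHl x0.
have x1 : 0 <= 1 + x by rewrite addr_ge0.
have lxx : 0 <= l%:R * x * x by rewrite !mulr_ge0.
rewrite exprS -natr1; apply: le_trans (ler_wpM2l x1 IHl).
have -> : (1 + x) * (1 + l%:R * x) = 1 + (l%:R + 1) * x + l%:R * x * x by ring.
by rewrite lerDl.
Qed.

(** If the differences of a whole family are, up to sign, the next members of
the family, pointwise bounds on all members suffice. *)
Lemma symbol_of_bounds K (g : nat -> R) (A : nat -> nat -> R) :
  (forall j, exists2 C, 0 <= C & forall n, `|A j n| <= C * (g n / n.+1%:R ^+ j)) ->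
  (forall j n, fdiff (A j) n = - A j.+1 n) ->
  forall j, symbol K (fun n => g n / n.+1%:R ^+ j) (A j).
Proof.
move=> Ab dA; elim: K => [|K IH] j; first by split.
split => //; rewrite (_ : fdiff _ = fun n => - A j.+1 n); last exact/funext.
rewrite (_ : (fun n => _ / _) = fun n => g n / n.+1%:R ^+ j.+1).
  exact: symbolN.
by apply/funext => n; rewrite exprSr invfM mulrA.
Qed.

End Symbol.

(** * Iterated summation by parts *)

Section Abel.
Context {R : realType}.
Implicit Types (g h a b c : nat -> R) (w : R[i]).

Lemma cabs_ge0 w : 0 <= cabs w.
Proof. by case: w => x y; rewrite sqrtr_ge0. Qed.

Lemma cabs_real (x : R) : cabs x%:C = `|x|.
Proof. by rewrite /= expr0n addr0 sqrtr_sqr. Qed.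

Lemma cabsX w n : cabs (w ^+ n) = cabs w ^+ n.
Proof.
by elim: n => [|n IH]; rewrite ?expr0 ?Normc.normc1// !exprS Normc.normcM IH.
Qed.

Lemma cabs_sum (F : nat -> R[i]) N P :
  cabs (\sum_(N <= n < P) F n) <= \sum_(N <= n < P) cabs (F n).
Proof.
elim/big_ind2: _ => [|x1 x2 y1 y2 h1 h2|//]; first by rewrite Normc.normc0.
by rewrite (le_trans (le_normcD _ _))// lerD.
Qed.

Lemma cabs_onem_gt0 w N : 1 <= N.+1%:R * cabs (1 - w) -> 0 < cabs (1 - w).
Proof.
by move=> h; rewrite -(@pmulr_rgt0 _ N.+1%:R)// (lt_le_trans ltr01).
Qed.

Lemma abel_summation a w N P : (N <= P)%N ->
  (1 - w) * (\sum_(N <= n < P) (a n)%:C * w ^+ n) =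
  (a N)%:C * w ^+ N - (a P)%:C * w ^+ P +
  w * \sum_(N <= n < P) (fdiff a n)%:C * w ^+ n.
Proof.
elim: P => [|P IH]; first by rewrite leqn0 => /eqP ->; rewrite !big_geq//; ring.
rewrite leq_eqVlt => /predU1P[->|]; first by rewrite !big_geq//; ring.
rewrite ltnS => NP; rewrite !big_nat_recr//= !mulrDr IH// /fdiff rmorphB/= exprS.
ring.
Qed.

(** K summations by parts. Each one divides by |1 - w| and replaces a by its
difference; the boundary terms of the j-th step are of size
g_N / ((N+1)^j |1 - w|^(j+1)), hence O(g_N / |1 - w|) because
(N+1) |1 - w| >= 1. The boundary term at P is kept: it disappears only in the
limit. *)
Lemma symbol_sum K g a : (forall n, 0 <= g n) -> symbol K g a ->
  exists2 C, 0 <= C & forall w N P, (N <= P)%N -> cabs w <= 1 ->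
    1 <= N.+1%:R * cabs (1 - w) ->
    cabs (\sum_(N <= n < P) (a n)%:C * w ^+ n) <=
    C * ((g N + g P * cabs w ^+ P) / cabs (1 - w) +
         (\sum_(N <= n < P) g n / n.+1%:R ^+ K) / cabs (1 - w) ^+ K).
Proof.
elim: K g a => [|K IH] g a g0 sa; have [A A0 aA] := symbol_bound _ _ _ sa.
  exists A => // w N P NP w1 Nw.
  have d0 := cabs_onem_gt0 w N Nw.
  rewrite (le_trans (cabs_sum _ _ _))// mulrDr ler_wpDl//.
    by rewrite mulr_ge0// divr_ge0 ?addr_ge0 ?mulr_ge0 ?exprn_ge0// ?cabs_ge0.
  rewrite expr0 divr1 mulr_sumr; apply: ler_sum => n _.
  rewrite Normc.normcM cabs_real cabsX expr0 divr1.
  by rewrite (le_trans _ (aA n))// ler_piMr// exprn_ile1 ?cabs_ge0.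
case: sa => _ sa.
have [|B B0 aB] := IH _ _ _ sa; first by move=> n; rewrite divr_ge0.
exists (A + B) => [|w N P NP w1 Nw]; first exact: addr_ge0.
have d0 := cabs_onem_gt0 w N Nw.
rewrite -(@ler_pM2l _ (cabs (1 - w)))// -Normc.normcM abel_summation//.
have := aB w N P NP w1 Nw.
have -> : \sum_(N <= n < P) g n / n.+1%:R / n.+1%:R ^+ K =
    \sum_(N <= n < P) g n / n.+1%:R ^+ K.+1.
  by apply: eq_bigr => n _; rewrite exprS invfM mulrA.
set T := \sum_(N <= n < P) (fdiff a n)%:C * _.
set S := \sum_(N <= n < P) _.
move=> hT.
have S0 : 0 <= S by apply: sumr_ge0 => n _; rewrite divr_ge0 ?exprn_ge0.
set d := cabs (1 - w) in d0 hT Nw *; set r := cabs w ^+ P in hT *.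
have r0 : 0 <= r by rewrite exprn_ge0 ?cabs_ge0.
have -> : d * ((A + B) * ((g N + g P * r) / d + S / d ^+ K.+1)) =
    A * (g N + g P * r) + B * ((g N + g P * r) + S / d ^+ K) + A * S / d ^+ K.
  by rewrite exprS; field; rewrite expf_neq0 ?gt_eqF.
rewrite ler_wpDr ?divr_ge0 ?mulr_ge0 ?exprn_ge0 ?(ltW d0)//.
rewrite (le_trans (le_normcD _ _))// lerD//.
  rewrite (le_trans (le_normcD _ _))// normcN !Normc.normcM !cabs_real !cabsX.
  rewrite -/r mulrDr mulrA lerD ?ler_wpM2r// (le_trans _ (aA N))// ler_piMr//.
  by rewrite exprn_ile1 ?cabs_ge0.
rewrite Normc.normcM (le_trans (ler_piMl _ w1)) ?cabs_ge0// (le_trans hT)//.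
have Nd M : (N <= M)%N -> g M / M.+1%:R / d <= g M.
  move=> NM; rewrite -mulrA ler_piMr// -invfM invf_le1 ?mulr_gt0//.
  by rewrite (le_trans Nw)// ler_wpM2r ?(ltW d0)// ler_nat.
rewrite ler_wpM2l// lerD2r mulrDl lerD ?Nd// mulrAC ler_wpM2r// Nd//.
Qed.

(** Telescoping against 2/(N+1) - 1/P. *)
Lemma sum_inv_sqr N P :
  \sum_(N <= n < P) (n.+1%:R ^+ 2 : R)^-1 <= 2 / N.+1%:R.
Proof.
have [PN|NP] := leqP P N; first by rewrite big_geq ?divr_ge0.
suff: \sum_(N <= n < P) (n.+1%:R ^+ 2 : R)^-1 <= 2 / N.+1%:R - P%:R^-1.
  by move/le_trans; apply; rewrite gerBl.
elim: P NP => // P IH; rewrite ltnS leq_eqVlt => /predU1P[<-|NP].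
  rewrite big_nat1; have -> : (2 / N.+1%:R - N.+1%:R^-1 : R) = N.+1%:R^-1 by field.
  by rewrite lef_pV2 ?posrE// expr2 ler_peMl// ler1n.
rewrite big_nat_recr 1?ltnW//= (le_trans (lerD (IH NP) (lexx _)))//.
have P0 : (0 : R) < P%:R by rewrite ltr0n (leq_trans _ NP).
rewrite -subr_ge0 (_ : _ - _ = (P%:R * P.+1%:R ^+ 2)^-1).
  by rewrite invr_ge0 mulr_ge0 ?exprn_ge0.
rewrite -[P.+1%:R]natr1; field; rewrite ?gt_eqF// ?ltr_wpDl//.
Qed.

(** With L from [symbol_growth], c_n / (n+1)^L is at most c_N / (N+1)^L for
n >= N. Taking L + 2 summations by parts leaves the convergent sum of
(n+1)^-2, and (N+1) |1 - w| >= 1 turns every power into c_N / |1 - w|. *)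
Lemma symbol_tail c : (forall n, 0 < c n) -> (forall K, symbol K c c) ->
  exists2 C, 0 <= C & forall w N P, (N <= P)%N -> cabs w <= 1 ->
    1 <= N.+1%:R * cabs (1 - w) ->
    cabs (\sum_(N <= n < P) (c n)%:C * w ^+ n) <=
    C * ((c N + c P * cabs w ^+ P) / cabs (1 - w)).
Proof.
move=> c0 sc; have [L cL] := symbol_growth _ c0 (sc 1%N).
have [|C C0 hC] := symbol_sum L.+2 _ _ _ (sc _); first by move=> n; exact: ltW.
exists (3 * C) => [|w N P NP w1 Nw]; first by rewrite mulr_ge0.
apply: le_trans (hC w N P NP w1 Nw) _.
have d0 := cabs_onem_gt0 w N Nw.
rewrite [3 * C]mulrC -mulrA ler_wpM2l//.
rewrite [leRHS](_ : _ = (c N + c P * cabs w ^+ P) / cabs (1 - w) +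
  2 * ((c N + c P * cabs w ^+ P) / cabs (1 - w))); last by ring.
rewrite lerD2l.
apply: (@le_trans _ _ (2 * (c N / cabs (1 - w)))); last first.
  rewrite ler_wpM2l// ler_pM2r ?invr_gt0// lerDl.
  by rewrite mulr_ge0 ?exprn_ge0 ?cabs_ge0// ltW.
have le1 : \sum_(N <= n < P) c n / n.+1%:R ^+ L.+2 <=
    c N / N.+1%:R ^+ L * (2 / N.+1%:R).
  rewrite (le_trans _ (ler_wpM2l _ (sum_inv_sqr N P)))//; last first.
    by rewrite divr_ge0 ?exprn_ge0// ltW.
  rewrite mulr_sumr big_nat_cond [leRHS]big_nat_cond.
  apply: ler_sum => n; rewrite andbT => /andP[Nn _].
  by rewrite -addn2 exprD invfM mulrA ler_wpM2r ?invr_ge0 ?exprn_ge0// cL.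
rewrite (le_trans (ler_wpM2r _ le1)) ?invr_ge0 ?exprn_ge0 ?(ltW d0)//.
set d := cabs (1 - w) in d0 Nw *.
rewrite (_ : _ / d ^+ _ = 2 * (c N / d) / (N.+1%:R * d) ^+ L.+1); last first.
  by rewrite exprMn !exprS; field; rewrite !expf_neq0 ?gt_eqF.
rewrite ler_piMr ?mulr_ge0 ?invr_ge0 ?(ltW (c0 _)) ?(ltW d0)//.
by rewrite invf_le1 ?exprn_gt0 ?mulr_gt0// exprn_ege1.
Qed.

End Abel.

(** * Lower integrals *)

Section Lower.
Context {d} {T : measurableType d} {R : realType}.
Variable mu : {measure set T -> \bar R}.
Local Open Scope ereal_scope.

(** Monotonicity read off the supremum over simple functions, in the form that
applies to moments of an arbitrary non-negative profile. *)
Lemma le_lower_integral (D : set T) (f g : T -> \bar R) :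
  (forall x, D x -> 0 <= f x) -> (forall x, D x -> f x <= g x) ->
  \int[mu]_(x in D) f x <= \int[mu]_(x in D) g x.
Proof.
move=> f0 fg; have g0 x : D x -> 0 <= g x.
  by move=> Dx; exact: le_trans (f0 x Dx) (fg x Dx).
rewrite !ge0_integralE//; apply: le_ereal_sup => _ [h /= hf <-].
exists h => // x /=; apply: le_trans (hf x) _; rewrite /patch; case: ifP => //.
by rewrite inE => /fg.
Qed.

Import HBNNSimple.

(** g is the supremum of countably many simple functions below f whose integrals
tend to that of f. If t is simple and t <= h f, then max (g, t/h) still lies
between g and f, so it has the same finite integral as g; the excess over g
therefore has integral 0, and t does not exceed h g plus that excess. *)
Lemma measurable_minorant (f : T -> R) : (forall x, (0 <= f x)%R) ->
  \int[mu]_x (f x)%:E < +oo ->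
  exists g : T -> R, [/\ measurable_fun setT g, forall x, (0 <= g x <= f x)%R &
    forall h : T -> R, measurable_fun setT h -> (forall x, (0 <= h x <= 1)%R) ->
      \int[mu]_x (h x * f x)%:E = \int[mu]_x (h x * g x)%:E].
Proof.
move=> f0 foo.
have f0' x : [set: T] x -> 0 <= (f x)%:E by rewrite lee_fin.
set I := \int[mu]_x (f x)%:E in foo.
have Ifin : I \is a fin_num by rewrite ge0_fin_numE// integral_ge0.
have IE : I = ereal_sup [set sintegral mu h |
    h in [set h : {nnsfun T >-> R} | forall x, (h x)%:E <= (f x)%:E]].
  by rewrite /I ge0_integralTE//= => x; exact: f0'.
have /choice[s sP] (k : nat) : exists s : {nnsfun T >-> R},
    (forall x, (s x <= f x)%R) /\ I - (k.+1%:R^-1)%:E < sintegral mu s.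
  have k0 : (0 < k.+1%:R^-1 :> R)%R by [].
  move: Ifin; rewrite IE => Ifin.
  have [_ [s sf <-] ks] := ub_ereal_sup_adherent k0 Ifin.
  by exists s; split => // x; rewrite -lee_fin; exact: sf.
have sub x : has_ubound (range (s ^~ x)).
  by exists (f x) => _ [k _ <-]; exact: (sP k).1.
pose g x := sups (s ^~ x) 0%N.
have sg k x : (s k x <= g x)%R.
  apply: ub_le_sup; last by exists k.
  by exists (f x) => _ [j _ <-]; exact: (sP j).1.
have gf x : (g x <= f x)%R.
  apply: ge_sup; first by exists (s 0%N x); exists 0%N.
  by move=> _ [j _ <-]; exact: (sP j).1.
have g0 x : (0 <= g x)%R by apply: le_trans (sg 0%N x).
have mg : measurable_fun setT g by apply: measurable_fun_sups.
have Ig : \int[mu]_x (g x)%:E = I.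
  apply/eqP; rewrite eq_le; apply/andP; split.
    by apply: le_lower_integral => x _; rewrite lee_fin.
  apply/lee_addgt0Pr => e e0.
  have [k ke] : exists k : nat, (k.+1%:R^-1 < e)%R.
    by exists (Num.truncn e^-1); rewrite invf_plt ?posrE// truncnS_gt.
  rewrite -leeBlDr//; apply: (@le_trans _ _ (sintegral mu (s k))).
    apply/ltW/(le_lt_trans _ (sP k).2)/leeB => //.
    by rewrite lee_fin ltW.
  rewrite -integralT_nnsfun; apply: le_lower_integral => x _;
    rewrite lee_fin//.
exists g; split => // [x|h mh h01]; first by rewrite g0 gf.
have h0 x : (0 <= h x)%R by case/andP: (h01 x).
apply/eqP; rewrite eq_le; apply/andP; split; last first.
  by apply: le_lower_integral => x _; rewrite lee_fin ?mulr_ge0// ler_wpM2l.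
rewrite ge0_integralTE/=; last by move=> x; rewrite lee_fin mulr_ge0.
apply: ge_ereal_sup => _ [/= t tf <-]; rewrite -integralT_nnsfun.
(* Where h vanishes, so does t, and t / h is 0 by convention. *)
pose q x := Num.max (g x) (t x / h x)%R.
have th x : (t x / h x <= f x)%R.
  have := tf x; rewrite lee_fin; have [->|hx] := eqVneq (h x) 0%R.
    by rewrite invr0 mulr0.
  by rewrite ler_pdivrMr 1?mulrC// lt_neqAle eq_sym hx h0.
have thE x : (t x = h x * (t x / h x))%R.
  have [hx|hx] := eqVneq (h x) 0%R; last by rewrite mulrCA divff ?mulr1.
  apply/eqP; rewrite hx mul0r eq_le fun_ge0 andbT -lee_fin.
  by have := tf x; rewrite hx mul0r.
have mhV : measurable_fun setT (fun x => (h x)^-1)%R.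
  rewrite (_ : (fun x => _) = (@powR R ^~ (-1)%R) \o h).
    by apply: measurableT_comp => //; exact: measurable_powR.
  by apply/funext => x /=; rewrite powR_inv1.
have mq : measurable_fun setT q.
  by apply: measurable_maxr => //; exact: measurable_funM.
have qg x : (0 <= q x - g x)%R by rewrite subr_ge0 le_max lexx.
have mqg : measurable_fun setT (fun x => q x - g x)%R by exact: measurable_funB.
have qg0 : \int[mu]_x (q x - g x)%:E = 0.
  apply/eqP; rewrite eq_le integral_ge0 ?andbT; last by move=> x _; rewrite lee_fin.
  rewrite -(@leeD2lE _ I)// adde0 -{1}Ig.
  rewrite -ge0_integralD//=; last 4 first.
  - by move=> x _; rewrite lee_fin.
  - exact/measurable_EFinP.
  - by move=> x _; rewrite lee_fin.
  - exact/measurable_EFinP.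
  apply: le_lower_integral => x _; rewrite -EFinD lee_fin addrC subrK.
    by rewrite le_max g0.
  by rewrite ge_max gf th.
apply: (@le_trans _ _ (\int[mu]_x ((h x * g x)%:E + (q x - g x)%:E))).
  apply: le_lower_integral => x _; rewrite -?EFinD lee_fin// {1}thE.
  have : (t x / h x <= q x)%R by rewrite le_max lexx orbT.
  move: (t x / h x)%R => z zq; rewrite (le_trans (ler_wpM2l (h0 x) zq))//.
  rewrite -lerBlDl -mulrBr ler_piMl//; by case/andP: (h01 x).
rewrite ge0_integralD//=.
- by rewrite qg0 adde0.
- by move=> x _; rewrite lee_fin mulr_ge0.
- by apply/measurable_EFinP; exact: measurable_funM.
- by move=> x _; rewrite lee_fin.
- exact/measurable_EFinP.
Qed.

End Lower.

(** * Differences of power moments *)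

Section Moments.
Context {R : realType}.

(** r^l (1 - r) is the smallest of the l+1 terms r^i (1 - r), i <= l, whose sum
is 1 - r^(l+1). *)
Lemma expr_onem_le (r : R) l : 0 <= r <= 1 ->
  l.+1%:R * r ^+ l * (1 - r) <= 1 - r ^+ l.+1.
Proof.
move=> /andP[r0 r1]; elim: l => [|l IH]; first by rewrite expr0 expr1 !mul1r.
have q : r ^+ l.+1 * (1 - r) <= 1 - r.
  by rewrite ler_piMl ?subr_ge0// exprn_ile1.
have := ler_wpM2l r0 IH; rewrite -!natr1 !exprS in q *.
move: (r ^+ l) (l%:R : R) q => p k q; lra.
Qed.

(** Write n >= l j with l = floor (n / j), and apply [expr_onem_le] to each of
the j factors r^l (1 - r^2) <= 2 r^l (1 - r); (l+1) j >= n+1 gives the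
constant. *)
Lemma expr_onem_sqr_le (r : R) n j : 0 <= r <= 1 ->
  r ^+ n * (1 - r ^+ 2) ^+ j <= (2 * j%:R) ^+ j / n.+1%:R ^+ j.
Proof.
move=> r01; have /andP[r0 r1] := r01.
case: j => [|j]; first by rewrite !expr0 divr1 mulr1 exprn_ile1.
have s1 : r ^+ 2 <= 1 by rewrite exprn_ile1.
set l := (n %/ j.+1)%N.
have ln : (l * j.+1 <= n)%N by rewrite leq_trunc_div.
have nl : (n.+1 <= l.+1 * j.+1)%N by rewrite ltn_ceil.
have rn : r ^+ n <= (r ^+ l) ^+ j.+1.
  by rewrite -exprM -(subnK ln) exprD ler_piMl ?exprn_ge0// exprn_ile1.
rewrite (le_trans (ler_wpM2r _ rn)) ?exprn_ge0 ?subr_ge0//.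
rewrite -exprMn -expr_div_n lerXn2r ?nnegrE ?mulr_ge0 ?exprn_ge0 ?subr_ge0//.
rewrite ler_pdivlMr//.
have h1 : r ^+ l * (1 - r ^+ 2) <= 2 * (r ^+ l * (1 - r)).
  rewrite [leRHS]mulrCA ler_wpM2l ?exprn_ge0//.
  by have := mulr_ge0 r0 (le_trans ler01 (lexx _)); nra.
have h2 : n.+1%:R <= l.+1%:R * j.+1%:R :> R by rewrite -natrM ler_nat.
have h3 : l.+1%:R * (r ^+ l * (1 - r)) <= 1.
  by rewrite mulrA (le_trans (expr_onem_le _ _ r01))// gerBl exprn_ge0.
rewrite (le_trans (ler_wpM2r _ h1))// -mulrA ler_wpM2l//.
have p0 : 0 <= r ^+ l * (1 - r) by rewrite mulr_ge0 ?exprn_ge0 ?subr_ge0.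
rewrite (le_trans (ler_wpM2l p0 h2))// mulrA [_ * l.+1%:R]mulrC.
by rewrite ler_piMl.
Qed.

(** A_(j,n) is the integral of rho^(2n) (1 - rho^2)^j f: increasing n by one
multiplies the integrand by rho^2, so a difference in n amounts to one more
factor rho^2 - 1. The difference of the integrals is taken with the measurable
minorant in place of f. *)
Lemma power_moment_differences d (T : measurableType d)
    (mu : {measure set T -> \bar R}) (f rho : T -> R) :
  (forall x, 0 <= f x) -> (\int[mu]_x (f x)%:E < +oo)%E ->
  measurable_fun setT rho -> (forall x, 0 <= rho x <= 1) ->
  exists A : nat -> nat -> R,
  [/\ forall n, A 0%N n = \int[mu]_x (rho x ^+ n.*2 * f x),
      forall j n, fdiff (A j) n = - A j.+1 n &
      forall j n, `|A j n| <= (2 * j%:R) ^+ j / n.+1%:R ^+ j *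
                              \int[mu]_x (rho x ^+ n * f x)].
Proof.
move=> f0 foo mrho rho01.
have [g [mg gf hg]] := measurable_minorant mu f f0 foo.
have g0 x : 0 <= g x by case/andP: (gf x).
have hgR (h : T -> R) : measurable_fun setT h -> (forall x, 0 <= h x <= 1) ->
    \int[mu]_x (h x * f x) = \int[mu]_x (h x * g x).
  by move=> mh h01; rewrite /Rintegral hg.
have ih (h : T -> R) : measurable_fun setT h -> (forall x, 0 <= h x <= 1) ->
    mu.-integrable setT (fun x => (h x * g x)%:E).
  move=> mh h01; apply/integrableP; split.
    by apply/measurable_EFinP; exact: measurable_funM.
  apply: le_lt_trans foo; apply: le_lower_integral => x _; rewrite /= lee_fin//.
  have /andP[h0 h1] := h01 x; have /andP[_ gfx] := gf x.
  by rewrite ger0_norm ?mulr_ge0// (le_trans _ gfx)// ler_piMl.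
have mX n : measurable_fun setT (fun x => rho x ^+ n) by exact: measurable_funX.
have X01 n x : 0 <= rho x ^+ n <= 1.
  by have /andP[r0 r1] := rho01 x; rewrite exprn_ge0// exprn_ile1.
pose H j n x := rho x ^+ n.*2 * (1 - rho x ^+ 2) ^+ j.
have mH j n : measurable_fun setT (H j n).
  apply: measurable_funM => //; apply: measurable_funX.
  exact: measurable_funB.
have H01 j n x : 0 <= H j n x <= 1.
  have /andP[r0 r1] := X01 2%N x; have /andP[s0 s1] := X01 n.*2 x.
  have t0 : 0 <= 1 - rho x ^+ 2 by rewrite subr_ge0.
  have u0 : 0 <= (1 - rho x ^+ 2) ^+ j by exact: exprn_ge0.
  apply/andP; split; first exact: mulr_ge0.
  by apply: mulr_ile1 => //; rewrite exprn_ile1// gerBl.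
exists (fun j n => \int[mu]_x (H j n x * g x)); split => [n|j n|j n].
- rewrite -hgR//; apply: eq_Rintegral => x _.
  by rewrite /H expr0 mulr1.
- rewrite /fdiff -opprB -RintegralB//=; [|exact: ih..]; congr (- _).
  apply: eq_Rintegral => x _; rewrite /H doubleS !exprS; ring.
- rewrite hgR// -RintegralZl//=; last exact: ih.
  rewrite ger0_norm; last first.
    by apply: Rintegral_ge0 => x _; rewrite mulr_ge0//; case/andP: (H01 j n x).
  apply: le_Rintegral => //=; first exact: ih.
    set c := _ / _.
    rewrite (_ : _ \o _ = fun x => c%:E * (rho x ^+ n * g x)%:E)%E.
      by apply: integrableZl => //; exact: ih.
    by apply/funext => x; rewrite /= EFinM.
  move=> x _; have -> : H j n x * g x =
      rho x ^+ n * (1 - rho x ^+ 2) ^+ j * (rho x ^+ n * g x).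
    by rewrite /H -addnn exprD; ring.
  apply: ler_wpM2r; last exact: expr_onem_sqr_le.
  by rewrite mulr_ge0//; case/andP: (X01 n x).
Qed.

Notation mu := (@completed_lebesgue_measure R).
Variable omega : R[i] -> R.
Hypothesis omega0 : forall z, unit_disk z -> 0 <= omega z.

Lemma unit_disk_real (r : R) : r \in `[0%R, 1%R[ -> unit_disk r%:C%C.
Proof.
rewrite in_itv/= => /andP[r0 r1].
by rewrite /unit_disk/= expr0n addr0 sqrtr_sqr ger0_norm.
Qed.

Lemma moment_ge0 (x : R) : (0 <= moment omega x)%E.
Proof.
apply: integral_ge0 => r rD; rewrite lee_fin mulr_ge0 ?powR_ge0//.
exact/omega0/unit_disk_real.
Qed.

Lemma moment_nincr (x y : R) : 1 <= x -> x <= y ->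
  (moment omega y <= moment omega x)%E.
Proof.
move=> x1 xy; have x0 : 0 < x by exact: lt_le_trans x1.
have y0 : 0 < y by exact: lt_le_trans xy.
apply: le_lower_integral => r rD; rewrite lee_fin.
  by rewrite mulr_ge0 ?powR_ge0//; exact/omega0/unit_disk_real.
apply: ler_wpM2r; first exact/omega0/unit_disk_real.
move: rD; rewrite /= in_itv/= => /andP[r0 r1].
move: r0; rewrite le_eqVlt => /predU1P[<-|r0].
  by rewrite !powR0 ?gt_eqF.
by apply: ger_powR => //; rewrite r0 ltW.
Qed.

Lemma measurable_completed (h : R -> R) :
  measurable_fun [set: measurableTypeR R] h ->
  measurable_fun [set: caratheodory_type (wlength (@idfun R))^*%mu] h.
Proof.
move=> mh _ Y mY; rewrite setTI; apply: sub_caratheodory.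
by have := mh measurableT Y mY; rewrite setTI.
Qed.

(** The factor r of r omega(r) accounts for the odd exponents 2n+1, and it makes
the finiteness of the first moment the integrability condition. *)
Lemma moment_differences : (moment omega 1 < +oo)%E ->
  exists A : nat -> nat -> R,
  [/\ forall n, A 0%N n = fine (moment omega n.*2.+1%:R),
      forall j n, fdiff (A j) n = - A j.+1 n &
      forall j n, `|A j n| <= (2 * j%:R) ^+ j / n.+1%:R ^+ j *
                              fine (moment omega n.+1%:R)].
Proof.
pose D : set R := [set` `[0%R, 1%R[].
pose f r := ((fun r => r * omega r%:C%C) \_ D) r.
pose rho r : R := r * \1_D r.
have f0 r : 0 <= f r.
  rewrite /f /patch; case: ifP => //; rewrite inE/= => rD.
  rewrite mulr_ge0//; last exact/omega0/unit_disk_real.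
  by case/andP: rD.
have mE n : moment omega n.+1%:R = (\int[mu]_r (rho r ^+ n * f r)%:E)%E.
  rewrite /moment integral_mkcond; apply: eq_integral => r _.
  rewrite /f /rho /patch indicE; case: ifP => //; last by rewrite mulr0.
  rewrite inE/= => rD; have /andP[r0 _] := rD.
  by rewrite mulr1 powR_mulrn// exprSr mulrA.
move=> fin1.
have [||r|A [A0 dA bA]] := @power_moment_differences _ _ mu f rho f0.
- move: fin1; rewrite -[1]/(1%:R) mE; congr (_ < _)%E; apply: eq_integral => r _.
  by rewrite expr0 mul1r.
- apply: measurable_completed; apply: measurable_funM => //.
  by apply: measurable_indic; exact: measurable_itv.
- rewrite /rho indicE; have [|_] := boolP (r \in D); last by rewrite mulr0 lexx ler01.
  by rewrite inE /D /= in_itv/= mulr1 => /andP[-> /ltW ->].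
exists A; split => // [n|j n]; first by rewrite A0 mE.
by rewrite (le_trans (bA j n))// mE.
Qed.

End Moments.

(** * Comparison of sums with the integral *)

Section DoublingMoments.
Context {R : realType}.
Variables (m : R -> R) (B : R).
Hypothesis m_gt0 : forall x, 1 <= x -> 0 < m x.
Hypothesis m_nincr : forall x y, 1 <= x -> x <= y -> m y <= m x.
Hypothesis B0 : 0 <= B.
Hypothesis m_dbl : forall x, 1 <= x -> m x <= B * m (2 * x).

Notation lambda := (@lebesgue_measure R).

Definition kernel_coef n := (n.+1%:R ^+ 2 * m n.*2.+1%:R)^-1.
Definition majorant b := \int[lambda]_(t in `[1, b]) (t ^+ 2 * m t)^-1.

Lemma kernel_coef_gt0 n : 0 < kernel_coef n.
Proof. by rewrite invr_gt0 mulr_gt0 ?exprn_gt0// m_gt0// ler1n. Qed.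

Lemma m_dbl2 x y : 1 <= x -> y <= 4 * x -> 1 <= y -> m x <= B ^+ 2 * m y.
Proof.
move=> x1 yx y1; have x2 : 1 <= 2 * x by rewrite mulr_ege1// ler1n.
rewrite (le_trans (m_dbl _ x1))// expr2 -mulrA ler_wpM2l//.
rewrite (le_trans (m_dbl _ x2))// ler_wpM2l// m_nincr//.
by rewrite mulrA -natrM.
Qed.

(** Both 1/t^2 and 1/m_t are monotone on [1, b]; extending them to the line by
freezing t at 1 makes monotone functions, hence measurable ones. *)
Lemma integrable_weight b :
  lambda.-integrable `[1, b] (EFin \o fun t => (t ^+ 2 * m t)^-1).
Proof.
have [b1|b1] := ltP b 1.
  by rewrite set_itv_ge ?bnd_simp -?ltNge//; exact: integrable_set0.
pose p t : R := Num.max 1 t.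
have p1 t : 1 <= p t by rewrite le_max lexx.
have ple s t : s <= t -> p s <= p t by move=> st; rewrite ge_max p1/= le_max st orbT.
apply: measurable_bounded_integrable => //.
- by rewrite /= lebesgue_measure_itv/=; case: ifP => _; rewrite ?ltry.
- apply: (@eq_measurable_fun _ _ _ _ _ (fun t => (p t ^+ 2)^-1 * (m (p t))^-1)).
    move=> t; rewrite inE/= in_itv/= => /andP[t1 _].
    by have -> : p t = t by [exact: max_r]; rewrite [RHS]invfM.
  apply: measurable_funM.
    apply: nonincreasing_measurable => // s t st.
    rewrite lef_pV2 ?posrE ?exprn_gt0 ?(lt_le_trans ltr01 (p1 _))//.
    by rewrite lerXn2r ?nnegrE ?(le_trans ler01 (p1 _))// ple.
  apply: nondecreasing_measurable => // s t st.
  by rewrite lef_pV2 ?posrE ?m_gt0// m_nincr// ple.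
- exists (m b)^-1; split; first by rewrite num_real.
  move=> M mM t /=; rewrite in_itv/= => /andP[t1 tb].
  have t0 : 0 < t by exact: lt_le_trans t1.
  rewrite ger0_norm ?invr_ge0 ?mulr_ge0 ?exprn_ge0 ?(ltW t0) ?(ltW (m_gt0 _ _))//.
  apply/ltW/(le_lt_trans _ mM).
  rewrite lef_pV2 ?posrE ?mulr_gt0 ?exprn_gt0 ?m_gt0//.
  rewrite (le_trans (m_nincr _ _ t1 tb))// ler_peMl ?(ltW (m_gt0 _ _))//.
  by rewrite exprn_ege1.
Qed.

(** On [a, b] the integrand is at least 1 / (b^2 m_a), m being nonincreasing. *)
Lemma majorant_step a b : 1 <= a -> a <= b ->
  majorant a + (b - a) / (b ^+ 2 * m a) <= majorant b.
Proof.
move=> a1 ab; have b1 : 1 <= b by exact: le_trans ab.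
rewrite -lerBrDl /majorant Rintegral_itvB ?bnd_simp//; last exact: integrable_weight.
have -> : (b - a) / (b ^+ 2 * m a) =
    \int[lambda]_(t in `]a, b]) (b ^+ 2 * m a)^-1.
  rewrite Rintegral_cst// /= lebesgue_measure_itv/= lte_fin.
  move: ab; rewrite le_eqVlt => /predU1P[->|ab].
    by rewrite ltxx subrr mul0r mulr0.
  by rewrite ab mulrC.
apply: le_Rintegral => //.
- apply: measurable_bounded_integrable => //.
    by rewrite /= lebesgue_measure_itv/=; case: ifP => _; rewrite ?ltry.
  exists (b ^+ 2 * m a)^-1; split; first by rewrite num_real.
  move=> M mM t _ /=; rewrite ger0_norm ?ltW//.
  by rewrite invr_gt0 mulr_gt0 ?exprn_gt0 ?m_gt0// (lt_le_trans ltr01).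
- apply: integrableS (integrable_weight b) => //.
  by apply: subset_itv; rewrite ?bnd_simp.
move=> t /=; rewrite in_itv/= => /andP[at_ tb].
have t1 : 1 <= t by rewrite (le_trans a1)// ltW.
have t0 : 0 < t by exact: lt_le_trans t1.
have b0 : 0 < b by exact: lt_le_trans b1.
rewrite lef_pV2 ?posrE ?mulr_gt0 ?exprn_gt0 ?m_gt0//.
apply: ler_pM; [exact/exprn_ge0/ltW|exact/ltW/m_gt0| |exact/m_nincr/ltW].
by rewrite lerXn2r ?nnegrE ?(ltW t0) ?(ltW b0).
Qed.

Lemma majorant_ge0 b : 1 <= b -> 0 <= majorant b.
Proof.
move=> b1; apply: Rintegral_ge0 => t /=; rewrite in_itv/= => /andP[t1 _].
by rewrite invr_ge0 mulr_ge0 ?exprn_ge0 ?(le_trans ler01 t1)// ltW// m_gt0.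
Qed.

Lemma majorant_ndecr a b : 1 <= a -> a <= b -> majorant a <= majorant b.
Proof.
move=> a1 ab; apply: le_trans (majorant_step _ _ a1 ab).
by rewrite lerDl divr_ge0 ?subr_ge0// mulr_ge0 ?sqr_ge0// ltW// m_gt0.
Qed.

(** The integral over [n, n+1] is at least 1 / ((n+1)^2 m_n), and two doublings
reach the exponent 2n+1 <= 4n. *)
Lemma kernel_coef_le n : (0 < n)%N ->
  kernel_coef n <= B ^+ 2 * (majorant n.+1%:R - majorant n%:R).
Proof.
move=> n0; have n1 : 1 <= n%:R :> R by rewrite ler1n.
have n2 : 1 <= n.*2.+1%:R :> R by rewrite ler1n.
have nS : n%:R <= n.+1%:R :> R by rewrite ler_nat.
have := majorant_step _ _ n1 nS; rewrite -lerBrDl -natrB// subSnn mul1r => h.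
apply: le_trans (ler_wpM2l (sqr_ge0 B) h).
have h2 : m n%:R <= B ^+ 2 * m n.*2.+1%:R.
  by apply: m_dbl2 => //; rewrite -natrM ler_nat; lia.
rewrite /kernel_coef !invfM mulrCA ler_wpM2l ?invr_ge0 ?exprn_ge0//.
by rewrite ler_pdivlMr ?m_gt0// ler_pdivrMl ?m_gt0// mulrC.
Qed.

(** The same comparison on [N, 2N], whose length gains a factor N. *)
Lemma kernel_coef_last N : (0 < N)%N ->
  N.+1%:R * kernel_coef N <= 4 * B ^+ 2 * (majorant N.*2%:R - majorant N%:R).
Proof.
move=> N0; have N1 : 1 <= N%:R :> R by rewrite ler1n.
have N2 : 1 <= N.*2.+1%:R :> R by rewrite ler1n.
have NN : N%:R <= N.*2%:R :> R by rewrite ler_nat; lia.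
have Np : 0 < N%:R :> R by rewrite ltr0n.
have := majorant_step _ _ N1 NN; rewrite -lerBrDl -natrB; last by lia.
rewrite -addnn addnK addnn => h.
apply: le_trans (ler_wpM2l (mulr_ge0 (ler0n _ 4) (sqr_ge0 B)) h).
have h2 : m N%:R <= B ^+ 2 * m N.*2.+1%:R.
  by apply: m_dbl2 => //; rewrite -natrM ler_nat; lia.
have mN := m_gt0 _ N1; have mN2 := m_gt0 _ N2.
rewrite /kernel_coef (_ : N.+1%:R * _ = N.+1%:R^-1 * (m N.*2.+1%:R)^-1); last first.
  by field; rewrite ?gt_eqF ?ltr_wpDl.
rewrite [leRHS](_ : _ = N%:R^-1 * (B ^+ 2 / m N%:R)); last first.
  by rewrite -muln2 natrM; field; rewrite !gt_eqF.
apply: ler_pM; rewrite ?invr_ge0 ?(ltW mN2)//.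
  by rewrite lef_pV2 ?posrE// ler_nat.
by rewrite ler_pdivlMr// ler_pdivrMl// mulrC.
Qed.

Lemma kernel_coef_sum_le N b : 1 <= b -> N.*2%:R <= b ->
  \sum_(0 <= n < N) kernel_coef n + N.+1%:R * kernel_coef N <=
  kernel_coef 0 + 4 * B ^+ 2 * majorant b.
Proof.
move=> b1 Nb; have B2 : 0 <= 4 * B ^+ 2 by rewrite mulr_ge0 ?sqr_ge0.
case: N Nb => [|N] Nb.
  by rewrite big_geq// add0r mul1r lerDl mulr_ge0// majorant_ge0.
rewrite big_nat_recl// -addrA lerD2l.
have sumle : \sum_(0 <= n < N) kernel_coef n.+1 <=
    B ^+ 2 * (majorant N.+1%:R - majorant 1).
  rewrite -[1]/(1%:R) -(telescope_sumr (fun n => majorant n.+1%:R)) // mulr_sumr.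
  by apply: ler_sum => n _; exact: kernel_coef_le.
have c1 : 0 <= majorant 1 by exact: majorant_ge0.
have cN : 0 <= majorant N.+1%:R by apply: majorant_ge0; rewrite ler1n.
have cb : majorant N.+1.*2%:R <= majorant b.
  by apply: majorant_ndecr => //; rewrite ler1n.
rewrite (le_trans (lerD sumle (kernel_coef_last _ _)))//.
have D0 := sqr_ge0 B; have := mulr_ge0 D0 c1; have := mulr_ge0 D0 cN.
have := ler_wpM2l D0 cb; move: (B ^+ 2) => D; lra.
Qed.

End DoublingMoments.

(** * Complex series *)

Section Cplx.
Context {R : realType}.
Local Notation C := (R[i] : numClosedFieldType).

Lemma cvg_complex (u : nat -> C) (x y : R) :
  (fun n => complex.Re (u n)) @ \oo --> x -> (fun n => complex.Im (u n)) @ \oo --> y ->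
  u @ \oo --> (x +i* y : C).
Proof.
move=> /cvgrPdist_lt ux /cvgrPdist_lt uy; apply/cvgrPdist_lt => -[e e'].
rewrite ltcE/= => /andP[/eqP-> e0].
have e20 : 0 < e / 2 by rewrite divr_gt0.
near=> n; rewrite normc_def ltcR/=.
have hx : `|x - complex.Re (u n)| < e / 2 by near: n; exact: ux.
have hy : `|y - complex.Im (u n)| < e / 2 by near: n; exact: uy.
case: (u n) hx hy => a b/= hx hy.
rewrite -(ger0_norm (ltW e0)) -sqrtr_sqr ltr_sqrt ?exprn_gt0//.
rewrite -[(x - a) ^+ 2]real_normK ?num_real// -[(y - b) ^+ 2]real_normK ?num_real//.
have := normr_ge0 (x - a); have := normr_ge0 (y - b); nra.
Unshelve. all: by end_near. Qed.

Lemma abs_Re_le (z : R[i]) : `|complex.Re z| <= cabs z.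
Proof. by case: z => a b /=; rewrite -sqrtr_sqr ler_wsqrtr// lerDl sqr_ge0. Qed.

Lemma abs_Im_le (z : R[i]) : `|complex.Im z| <= cabs z.
Proof. by case: z => a b /=; rewrite -sqrtr_sqr ler_wsqrtr// lerDr sqr_ge0. Qed.

Lemma Re_sum (u : nat -> C) n :
  complex.Re (series u n) = series (fun k => complex.Re (u k)) n.
Proof.
rewrite /series/=; elim: n => [|n IH]; first by rewrite !big_geq.
by rewrite !big_nat_recr//= -IH; case: (\sum_(_ <= _ < _) _) (u n) => a b [].
Qed.

Lemma Im_sum (u : nat -> C) n :
  complex.Im (series u n) = series (fun k => complex.Im (u k)) n.
Proof.
rewrite /series/=; elim: n => [|n IH]; first by rewrite !big_geq.
by rewrite !big_nat_recr//= -IH; case: (\sum_(_ <= _ < _) _) (u n) => a b [].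
Qed.

(** A domination argument on real and imaginary parts, each of which converges
in the reals. *)
Lemma cabs_lim_series_le (u : nat -> C) (B : R) (v b : R^nat) :
  cvgn (series v) -> (forall n, cabs (u n) <= v n) ->
  b @ \oo --> B -> (\forall P \near \oo, cabs (series u P) <= b P) ->
  cabs (limn (series u)) <= B.
Proof.
move=> cv uv bB ub.
have v0 n : 0 <= v n by apply: le_trans (uv n); case: (u n) => x y; exact: sqrtr_ge0.
have cvx : cvgn (series (fun k => complex.Re (u k))).
  apply: normed_cvg; apply: (series_le_cvg _ v0 _ cv) => n; first exact: normr_ge0.
  exact: le_trans (abs_Re_le _) (uv n).
have cvy : cvgn (series (fun k => complex.Im (u k))).
  apply: normed_cvg; apply: (series_le_cvg _ v0 _ cv) => n; first exact: normr_ge0.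
  exact: le_trans (abs_Im_le _) (uv n).
set x := limn (series (fun k => complex.Re (u k))).
set y := limn (series (fun k => complex.Im (u k))).
have lx : (fun n => complex.Re (series u n)) @ \oo --> x.
  by under eq_fun do rewrite Re_sum.
have ly : (fun n => complex.Im (series u n)) @ \oo --> y.
  by under eq_fun do rewrite Im_sum.
have -> : limn (series u) = x +i* y.
  by apply: cvg_lim (cvg_complex _ _ _ lx ly).
apply: (ler_cvg_to _ bB ub).
rewrite [X in X @ _ --> _](_ : _ = fun P => Num.sqrt
    (complex.Re (series u P) * complex.Re (series u P) +
     complex.Im (series u P) * complex.Im (series u P))); last first.
  by apply/funext => P; case: (series u P) => p q; rewrite /= !expr2.
rewrite /= !expr2; apply: continuous_cvg; first exact: sqrt_continuous.
by apply: cvgD; apply: cvgM.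
Qed.
End Cplx.

(** * The coefficients of the kernel *)

Section Final.
Context {R : realType}.
Local Notation C := (R[i] : numClosedFieldType).

(** Polynomial growth of degree L against rho^n: with s the (L+1)-st root of
rho, each of the L factors (n+1) s^n is at most 1 / (1 - s), and one factor s^n
is left. *)
Lemma symbol_geometric (c : nat -> R) (rho : R) : (forall n, 0 < c n) ->
  symbol 1 c c -> 0 <= rho < 1 ->
  exists D s, [/\ 0 <= D, 0 <= s < 1 & forall n, c n * rho ^+ n <= D * s ^+ n].
Proof.
move=> c0 sc /andP[r0 r1]; have [L cL] := symbol_growth _ c0 sc.
pose s := rho `^ (L.+1%:R^-1).
have s0 : 0 <= s by exact: powR_ge0.
have sL : s ^+ L.+1 = rho.
  by rewrite -powR_mulrn// -powRrM mulVf// powRr1.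
have s1 : s < 1.
  by rewrite -(@expr_lt1 _ L.+1)// sL.
exists (c 0%N / (1 - s) ^+ L), s; split; last first.
- move=> n; have h1 : n.+1%:R * s ^+ n <= (1 - s)^-1.
    rewrite -[leRHS]mul1r ler_pdivlMr ?subr_gt0//.
    apply: le_trans (expr_onem_le s n _) _; first by rewrite s0 ltW.
    by rewrite gerBl exprn_ge0.
  have h2 : c n <= c 0%N * n.+1%:R ^+ L.
    have := cL 0%N n (leq0n _); rewrite expr1n divr1.
    by rewrite ler_pdivrMr// exprn_gt0.
  rewrite (le_trans (ler_wpM2r _ h2)) ?exprn_ge0// -!mulrA.
  rewrite ler_wpM2l ?(ltW (c0 _))//.
  have -> : rho ^+ n = (s ^+ n) ^+ L * s ^+ n.
    by rewrite -sL -!exprM -exprD mulSn mulnC addnC.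
  rewrite mulrA ler_wpM2r ?exprn_ge0//.
  rewrite -exprMn -exprVn; apply: lerXn2r => //; rewrite nnegrE.
    by rewrite mulr_ge0 ?exprn_ge0.
  by rewrite invr_ge0 subr_ge0 ltW.
- by rewrite s0 s1.
- by rewrite divr_ge0 ?exprn_ge0 ?subr_ge0 ?ltW.
Qed.

(** The moments are symbols by [symbol_of_bounds], doubling bringing the exponent
n+1 back to 2n+1; multiply by n+1 twice and invert. *)
Lemma kernel_coef_symbol (m : R -> R) (B : R) (A : nat -> nat -> R) :
  (forall x, 1 <= x -> 0 < m x) ->
  (forall x y, 1 <= x -> x <= y -> m y <= m x) ->
  0 <= B -> (forall x, 1 <= x -> m x <= B * m (2 * x)) ->
  (forall n, A 0%N n = m n.*2.+1%:R) ->
  (forall j n, fdiff (A j) n = - A j.+1 n) ->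
  (forall j n, `|A j n| <= (2 * j%:R) ^+ j / n.+1%:R ^+ j * m n.+1%:R) ->
  forall K, symbol K (kernel_coef m) (kernel_coef m).
Proof.
move=> m0 mdec B0 mdbl A0 dA bA K.
have ge1 n : 1 <= n.+1%:R :> R by rewrite ler1n.
have B2 : 0 <= B ^+ 2 by exact: sqr_ge0.
have dbl2 := @m_dbl2 _ m B mdec B0 mdbl.
have symM : symbol K (fun n => m n.*2.+1%:R) (fun n => m n.*2.+1%:R).
  have := symbol_of_bounds K (fun n => m n.*2.+1%:R) A _ dA 0%N.
  rewrite (_ : A 0%N = fun n => m n.*2.+1%:R); last exact/funext.
  rewrite (_ : (fun n => _ / _) = fun n => m n.*2.+1%:R); last first.
    by apply/funext => n; rewrite expr0 divr1.
  apply=> j; exists ((2 * j%:R) ^+ j * B ^+ 2).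
    by rewrite mulr_ge0// exprn_ge0// mulr_ge0.
  move=> n; apply: le_trans (bA j n) _.
  rewrite [leRHS](_ : _ = (2 * j%:R) ^+ j / n.+1%:R ^+ j *
    (B ^+ 2 * m n.*2.+1%:R)); last by ring.
  rewrite ler_wpM2l ?divr_ge0 ?exprn_ge0 ?mulr_ge0//.
  by apply: dbl2 => //; rewrite -natrM ler_nat; lia.
have le2 n : n.+2%:R <= 2 * n.+1%:R :> R by rewrite -natrM ler_nat; lia.
have sym2 := symbolM K _ _ _ _ 2 (ler0n _ _) (fun n => ler0n _ _) le2
  (symbol_natS K) (symbol_natS K).
have Mdec n : m n.+1.*2.+1%:R <= 1 * m n.*2.+1%:R.
  by rewrite mul1r mdec// ler_nat; lia.
have M0 n : 0 <= m n.*2.+1%:R by exact/ltW/m0.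
have symp := symbolM K _ _ _ _ 1 ler01 M0 Mdec sym2 symM.
have e : (fun n => n.+1%:R * n.+1%:R * m n.*2.+1%:R) =
         (fun n => n.+1%:R ^+ 2 * m n.*2.+1%:R) by [].
rewrite e in symp; apply: (symbolV K _ (B ^+ 2) B2 _ _ symp) => n.
  by rewrite mulr_gt0 ?m0.
rewrite mulrCA ler_pM ?exprn_ge0//.
  by rewrite lerXn2r ?nnegrE ?ler_nat.
by apply: dbl2 => //; rewrite -natrM ler_nat; lia.
Qed.

(** Head and tail at N = floor (1 / |1 - w|), for which 2N <= kappa and
1 / |1 - w| < N+1; the boundary term at P tends to 0 geometrically. *)
Lemma kernel_series_bound (m : R -> R) (B : R) :
  (forall x, 1 <= x -> 0 < m x) ->
  (forall x y, 1 <= x -> x <= y -> m y <= m x) ->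
  0 <= B -> (forall x, 1 <= x -> m x <= B * m (2 * x)) ->
  (forall K, symbol K (kernel_coef m) (kernel_coef m)) ->
  exists2 K, 0 < K & forall w : C, cabs w < 1 ->
    cabs (limn [series w ^+ n / (n.+1%:R ^+ 2 * m n.*2.+1%:R)%:C]_n) <=
    K * (majorant m (2 / cabs (1 - w)) + 1).
Proof.
move=> m0 mdec B0 mdbl symc; set c := kernel_coef m in symc.
have c0 n : 0 < c n by exact: kernel_coef_gt0.
have [C1 C10 hC1] := symbol_tail c c0 symc.
pose E := c 0%N + 4 * B ^+ 2.
have E0 : 0 < E by rewrite ltr_wpDr ?mulr_ge0 ?sqr_ge0.
exists ((1 + C1) * E) => [|w w1]; first by rewrite mulr_gt0// ltr_wpDr.
set d := cabs (1 - w); have d0 : 0 < d.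
  rewrite lt_neqAle cabs_ge0 andbT; apply/eqP => /esym/Normc.eq0_normc/eqP.
  by rewrite subr_eq0 => /eqP e; rewrite -e Normc.normc1 ltxx in w1.
have d2 : d <= 2.
  rewrite (le_trans (le_normcD _ _))// normcN Normc.normc1.
  by rewrite -[2]/(1 + 1) lerD2l ltW.
pose N := Num.truncn d^-1.
have Nd : N%:R <= d^-1 by rewrite truncn_le// invr_ge0 ltW.
have dN : d^-1 < N.+1%:R by rewrite truncnS_gt.
have Nd1 : 1 <= N.+1%:R * d by rewrite -ler_pdivrMr// mul1r ltW.
have rho01 : 0 <= cabs w < 1 by rewrite cabs_ge0.
have [D [s [D0 s01 cs]]] := symbol_geometric c _ c0 (symc 1%N) rho01.
have /andP[s0 s1] := s01.
pose F := \sum_(0 <= n < N) c n + N.+1%:R * c N.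
pose b P := (1 + C1) * F + C1 * N.+1%:R * (D * s ^+ P).
have uE n : w ^+ n / (n.+1%:R ^+ 2 * m n.*2.+1%:R)%:C = (c n)%:C * w ^+ n.
  by rewrite mulrC /c /kernel_coef fmorphV.
have FE : (1 + C1) * F <= (1 + C1) * E * (majorant m (2 / d) + 1).
  have k1 : 1 <= 2 / d by rewrite ler_pdivlMr// mul1r.
  have I0 : 0 <= majorant m (2 / d) by exact: majorant_ge0.
  rewrite -mulrA ler_wpM2l ?addr_ge0//.
  have Nk : N.*2%:R <= 2 / d by rewrite -mul2n natrM ler_wpM2l.
  apply: le_trans (kernel_coef_sum_le m B m0 mdec B0 mdbl N _ k1 Nk) _.
  rewrite mulrDr mulr1 addrC lerD//; last by rewrite lerDl mulr_ge0 ?sqr_ge0.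
  by rewrite ler_wpM2r// lerDr ltW.
apply: le_trans FE; apply: (cabs_lim_series_le _ _ (geometric D s) b).
- by apply: is_cvg_geometric_series; rewrite ger0_norm.
- by move=> n; rewrite /= uE Normc.normcM cabs_real cabsX ger0_norm ?(ltW (c0 _)).
- rewrite -[X in _ --> X]addr0 -(mulr0 (C1 * N.+1%:R)).
  apply: cvgD; first exact: cvg_cst.
  apply: cvgM; first exact: cvg_cst.
  by apply: cvg_geometric; rewrite ger0_norm.
- exists N => // P /= NP.
  rewrite (_ : series _ P = \sum_(0 <= n < P) (c n)%:C * w ^+ n); last first.
    by apply: eq_bigr => n _; exact: uE.
  rewrite (big_cat_nat (leq0n N) NP)/= (le_trans (le_normcD _ _))//.
  have h1 : cabs (\sum_(0 <= n < N) (c n)%:C * w ^+ n) <= \sum_(0 <= n < N) c n.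
    rewrite (le_trans (cabs_sum _ _ _))//; apply: ler_sum => n _.
    rewrite Normc.normcM cabs_real cabsX ger0_norm ?(ltW (c0 _))//.
    by rewrite ler_piMr ?(ltW (c0 _))// exprn_ile1 ?cabs_ge0// ltW.
  have h2 := hC1 w N P NP (ltW w1) Nd1.
  have h3 : C1 * ((c N + c P * cabs w ^+ P) / d) <=
      C1 * (N.+1%:R * c N) + C1 * N.+1%:R * (D * s ^+ P).
    rewrite -mulrA -mulrDr ler_wpM2l// mulrC -mulrDr.
    apply: ler_pM; rewrite ?invr_ge0 ?(ltW d0) ?(ltW dN)//.
      by rewrite addr_ge0 ?mulr_ge0 ?exprn_ge0 ?cabs_ge0// ltW.
    by rewrite lerD2l.
  apply: le_trans (lerD h1 (le_trans h2 h3)) _.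
  rewrite /b addrA lerD2r /F mulrDl mul1r -subr_ge0.
  rewrite (_ : _ - _ = N.+1%:R * c N + C1 * \sum_(0 <= n < N) c n); last ring.
  rewrite addr_ge0 ?mulr_ge0 ?(ltW (c0 _))//.
  by apply: sumr_ge0 => n _; exact: ltW.
Qed.

(** Iterating the doubling condition bounds the first moment by a multiple of
any other one, while monotonicity bounds the others by the first; so all
moments are 0, or all infinite, or all positive and finite. The map fine sends
both 0 and +oo to 0. *)
Lemma moment_dichotomy (omega : R[i] -> R) : Dhat omega ->
  (forall x : R, 1 <= x -> fine (moment omega x) = 0) \/
  ((moment omega 1 < +oo)%E /\ forall x : R, 1 <= x ->
    (0 < fine (moment omega x)) /\ moment omega x \is a fin_num).
Proof.
case=> -[om0 _] _ _ [B B0 dbl].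
have M0 := moment_ge0 omega om0; have Mdec := moment_nincr omega om0.
have growth k : (moment omega 1 <= (B ^+ k)%:E * moment omega (2 ^+ k))%E.
  elim: k => [|k IH]; first by rewrite expr0 mul1e.
  apply: le_trans IH _; rewrite exprSr EFinM -muleA lee_pmul2l ?fin_numE//.
    by rewrite exprS dbl// exprn_ege1// ler1n.
  by rewrite lte_fin exprn_gt0.
have lower (x : R) : 1 <= x ->
    exists2 D : R, 0 < D & (moment omega 1 <= D%:E * moment omega x)%E.
  move=> x1; pose k := Num.truncn x; have xk : x <= 2 ^+ k.+1.
    rewrite (le_trans (ltW (truncnS_gt _)))// -natrX ler_nat.
    exact/ltnW/ltn_expl.
  exists (B ^+ k.+1); first by rewrite exprn_gt0.
  apply: le_trans (growth k.+1) _; rewrite lee_pmul2l ?fin_numE//.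
    exact: Mdec.
  by rewrite lte_fin exprn_gt0.
have [oo1|fin1] := eqVneq (moment omega 1) +oo%E.
  left=> x /lower[D D0]; rewrite oo1 leye_eq => /eqP.
  by have := M0 x; case: (moment omega x) => //= r _; rewrite -EFinM.
have M1oo : (moment omega 1 < +oo)%E by rewrite ltey.
have Mfin (x : R) : 1 <= x -> moment omega x \is a fin_num.
  move=> x1; rewrite ge0_fin_numE//; apply: le_lt_trans M1oo.
  exact: Mdec.
have [z1|nz1] := eqVneq (moment omega 1) 0%E; [left|right; split] => // x x1.
  have : (moment omega x <= 0)%E by rewrite -z1 Mdec.
  by move=> h; apply/eqP; rewrite fine_eq0 ?Mfin// eq_le h M0.
split; last exact: Mfin.
rewrite fine_gt0// lt_neqAle eq_sym M0 andbT ltey_eq Mfin// andbT.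
have [D D0] := lower x x1; apply: contraTneq => ->.
by rewrite mule0 -ltNge lt_neqAle eq_sym nz1 M0.
Qed.

End Final.

(** * The estimate *)

Theorem mainTheorem9 (R : realType) (omega : R[i] -> R) (homega : Dhat omega) :
  exists2 C : R, 0 < C &
    forall a z : R[i], unit_disk a -> unit_disk z ->
      cabs (dirichlet_kernel omega a z - 1) <=
        C * cabs (a^* * z) *
          (\int[lebesgue_measure]_(t in `[1, kappa a z])
             (t ^+ 2 * fine (moment omega t))^-1 + 1).
Proof.
have kernelE (a z : R[i]) : cabs (dirichlet_kernel omega a z - 1) =
    cabs (a^* * z) / 2 * cabs (limn [series (a^* * z) ^+ n /
                 (n.+1%:R ^+ 2 * fine (moment omega n.*2.+1%:R))%:C]_n).
  rewrite /dirichlet_kernel addrC addKr !Normc.normcM Normc.normcV.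
  by rewrite (_ : cabs 2 = 2)// normcMn Normc.normc1.
have [m0|[M1oo m0]] := moment_dichotomy omega homega.
  (* Every coefficient is the inverse of 0, which is 0. *)
  exists 1 => // a z _ _; rewrite kernelE.
  rewrite (_ : limn _ = 0); last first.
    rewrite (_ : [series _]_n = fun=> 0).
      by apply: cvg_lim => //; exact: cvg_cst.
    apply/funext => P; rewrite /series/=; apply: big1 => n _.
    by rewrite m0 ?ler1n// mulr0 invr0 mulr0.
  rewrite Normc.normc0 mulr0 mul1r mulr_ge0 ?cabs_ge0// addr_ge0//.
  apply: Rintegral_ge0 => t /=; rewrite in_itv/= => /andP[t1 _].
  by rewrite m0// mulr0 invr0.
pose m x := fine (moment omega x).
have [[om0 _] _ _ [B B0 dbl]] := homega.
have mpos x : 1 <= x -> 0 < m x by move=> /m0[].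
have mdec x y : 1 <= x -> x <= y -> m y <= m x.
  move=> x1 xy; rewrite fine_le ?(m0 _ _).2 ?moment_nincr//.
  exact: le_trans xy.
have mdbl x : 1 <= x -> m x <= B * m (2 * x).
  move=> x1; have x2 : 1 <= 2 * x by rewrite mulr_ege1// ler1n.
  by rewrite -lee_fin EFinM /m !fineK ?(m0 _ _).2// dbl.
have [A [A0 dA bA]] := moment_differences omega om0 M1oo.
have symc := kernel_coef_symbol m B A mpos mdec (ltW B0) mdbl A0 dA bA.
have [K K0 hK] := kernel_series_bound m B mpos mdec (ltW B0) mdbl symc.
exists K => // a z a1 z1; rewrite kernelE [K * _]mulrC -!mulrA ler_wpM2l ?cabs_ge0//.
have w1 : cabs (a^* * z) < 1.
  rewrite Normc.normcM (_ : cabs a^* = cabs a); last first.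
    by case: (a) => x y /=; rewrite sqrrN.
  by rewrite mulr_ilt1 ?cabs_ge0.
apply: le_trans (hK _ w1); rewrite ler_piMl ?cabs_ge0// invf_le1// ler1n//.
Qed.
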